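(* There exists a function $\Phi\in L^\infty(\mathcal B(\ell^2))$ such that $\Phi$ satisfies condition (C) below (and $\Phi$ is very badly approximable), but $\Phi$ has infinitely many superoptimal approximants. (C) For each $\sigma>t_\infty(\Phi):=\lim_{j\to\infty}t_j(\Phi)$, there exist finitely many functions $\xi_1,\dots,\xi_l\in\operatorname{Ker}T_\Phi\subset H^2(\ell^2)$ such that $\mathfrak S_\Phi^{(\sigma)}(\zeta)=\operatorname{span}\{\xi_1(\zeta),\dots,\xi_l(\zeta)\}$ for almost all $\zeta\in\mathbb T$, where $\mathfrak S_\Phi^{(\sigma)}(\zeta)\subset\ell^2$ is the linear span of the Schmidt vectors of $\Phi(\zeta)$ that correspond to the singular values of $\Phi(\zeta)$ greater than or equal to $\sigma$.
   Context: $\mathbb T$ is the unit circle. $\mathcal B(\ell^2)$ is the space of bounded linear operators on $\ell^2$. $L^\infty(\mathcal B(\ell^2))$ is the space of weakly measurable essentially bounded $\mathcal B(\ell^2)$-valued functions on $\mathbb T$; $H^\infty(\mathcal B(\ell^2))$ is its subspace of (boundary values of) bounded analytic functions. $H^2(\ell^2)$ is the Hardy space of $\ell^2$-valued functions, $\mathbb P_+$ is the orthogonal projection of $L^2(\ell^2)$ onto $H^2(\ell^2)$, and the Toeplitz operator $T_\Phi:H^2(\ell^2)\to H^2(\ell^2)$ is $T_\Phi f=\mathbb P_+(\Phi f)$. Singular values of a bounded operator $A$: $s_j(A)=\inf\{\|A-K\|:\operatorname{rank}K\le j\}$, $j\ge0$. A nonzero vector $x$ is a Schmidt vector of $A$ corresponding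 to a singular value $s$ if $A^*Ax=s^2x$. Superoptimal approximation: for $\Phi\in L^\infty(\mathcal B(\ell^2))$ define inductively $\boldsymbol\Omega_0=\{F\in H^\infty(\mathcal B(\ell^2)): F \text{ minimizes } \operatorname{ess\,sup}_{\zeta}\|\Phi(\zeta)-F(\zeta)\|\}$, with minimal value $t_0=t_0(\Phi)$, and for $j\ge1$, $\boldsymbol\Omega_j=\{F\in\boldsymbol\Omega_{j-1}: F\text{ minimizes }\operatorname{ess\,sup}_{\zeta}s_j(\Phi(\zeta)-F(\zeta))\}$, with minimal value $t_j=t_j(\Phi)$. The numbers $t_j(\Phi)$ are the superoptimal singular values of $\Phi$. Functions in $\bigcap_{j\ge0}\boldsymbol\Omega_j$ are the superoptimal approximants of $\Phi$. $\Phi$ is very badly approximable if the zero function is a superoptimal approximant of $\Phi$. *)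

(* Defs.v *)
From HB Require Import structures.
From mathcomp Require Import all_boot all_order all_algebra.
From mathcomp Require Import complex.
From mathcomp Require Import all_classical all_reals all_analysis.
From mathcomp Require Import ess_sup_inf ring.

Set Implicit Arguments.
Unset Strict Implicit.
Unset Printing Implicit Defensive.

Import Order.TTheory GRing.Theory Num.Theory.
Import numFieldTopology.Exports numFieldNormedType.Exports.

Local Open Scope classical_set_scope.
Local Open Scope ring_scope.
Local Open Scope complex_scope.

(* The real-valued modulus; the library norm `|z| takes its values in R[i]. *)
Notation cmod := Normc.normc.

Section Circle.
Variable R : realType.

Record circle : Type := MkCircle { cval :> R[i]; _ : `|cval| == 1 }.

HB.instance Definition _ := [isSub for cval].
HB.instance Definition _ := [Choice of circle by <:].

Lemma expi_subproof (t : R) : `|cos t +i* sin t| == 1 :> R[i].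
Proof. by rewrite normc_def/= cos2Dsin2 sqrtr1. Qed.

Definition expi (t : R) : circle := MkCircle (expi_subproof t).

HB.instance Definition _ := isPointed.Build circle (expi 0).

(* expi maps [0, 2 pi[ onto the circle by a Borel isomorphism, so the
   sigma-algebra below is the Borel one. *)
Definition circle_measurable : set (set circle) :=
  [set A | measurable (expi @^-1` A : set (measurableTypeR R))].

Lemma circle_measurable0 : circle_measurable set0.
Proof. by rewrite /circle_measurable/= preimage_set0. Qed.

Lemma circle_measurableC A :
  circle_measurable A -> circle_measurable (~` A).
Proof. by rewrite /circle_measurable/= preimage_setC; exact: measurableC. Qed.

Lemma circle_measurable_bigcup (F : (set circle)^nat) :
  (forall i, circle_measurable (F i)) -> circle_measurable (\bigcup_i F i).
Proof.
by rewrite /circle_measurable/= preimage_bigcup => mF; exact: bigcupT_measurable.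
Qed.

HB.instance Definition _ := isMeasurable.Build default_measure_display circle
  circle_measurable0 circle_measurableC circle_measurable_bigcup.

Lemma measurable_expi :
  measurable_fun [set: measurableTypeR R] (expi : measurableTypeR R -> circle).
Proof. by move=> _ A mA; rewrite setTI. Qed.

Lemma twopi_gt0 : 0 < pi *+ 2 :> R.
Proof. by rewrite pmulrn_rgt0 ?pi_gt0. Qed.

(* Normalized Lebesgue measure on the circle. *)
Definition circle_measure : set circle -> \bar R :=
  pushforward (uniform_prob twopi_gt0) (expi : measurableTypeR R -> circle).

Let circle_measure0 : circle_measure set0 = 0%E.
Proof. by rewrite /circle_measure /pushforward preimage_set0 measure0. Qed.

Let circle_measure_ge0 A : (0 <= circle_measure A)%E.
Proof. by rewrite /circle_measure /pushforward; exact: measure_ge0. Qed.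

Let circle_measure_sigma_additive : semi_sigma_additive circle_measure.
Proof.
move=> F mF tF mUF; rewrite /circle_measure /pushforward preimage_bigcup.
apply: measure_semi_sigma_additive => //.
apply/trivIsetP => /= i j _ _ ij; rewrite -preimage_setI.
by move/trivIsetP : tF => /(_ _ _ _ _ ij) ->//; rewrite preimage_set0.
Qed.

HB.instance Definition _ := isMeasure.Build _ _ _ circle_measure
  circle_measure0 circle_measure_ge0 circle_measure_sigma_additive.

Definition cintegral (f : circle -> R[i]) : R[i] :=
  (\int[circle_measure]_z complex.Re (f z)) +i*
  (\int[circle_measure]_z complex.Im (f z)).

Definition cmeasurable (f : circle -> R[i]) : Prop :=
  measurable_fun setT (fun z => complex.Re (f z)) /\
  measurable_fun setT (fun z => complex.Im (f z)).

End Circle.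

Section Ell2.
Variable R : realType.

Definition square_summable : {pred nat -> R[i]} :=
  fun x => `[< cvgn (series (fun n => cmod (x n) ^+ 2)) >].

Lemma cmod_ge0 (z : R[i]) : 0 <= cmod z.
Proof. by case: z => a b; rewrite sqrtr_ge0. Qed.

Lemma cmod_sqr_lin (a x y : R[i]) :
  cmod (a * x + y) ^+ 2 <= 2 * cmod a ^+ 2 * cmod x ^+ 2 + 2 * cmod y ^+ 2.
Proof.
have h : cmod (a * x + y) <= cmod a * cmod x + cmod y.
  by rewrite -Normc.normcM le_normcD.
apply: (@le_trans _ _ ((cmod a * cmod x + cmod y) ^+ 2)).
  by rewrite lerXn2r// nnegrE ?addr_ge0 ?mulr_ge0 ?cmod_ge0.
rewrite -subr_ge0 (_ : _ - _ = (cmod a * cmod x - cmod y) ^+ 2) ?sqr_ge0//.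
by ring.
Qed.

Let cvg_lin_bound (a : R[i]) (x y : nat -> R[i]) :
  cvgn (series (fun n => cmod (x n) ^+ 2)) ->
  cvgn (series (fun n => cmod (y n) ^+ 2)) ->
  cvgn (series ((2 * cmod a ^+ 2) *: (fun n => cmod (x n) ^+ 2) +
                2 *: (fun n => cmod (y n) ^+ 2) : R^nat)).
Proof. by move=> cx cy; apply: is_cvg_seriesD; exact: is_cvg_seriesZ. Qed.

Lemma square_summable_submod : submod_closed square_summable.
Proof.
split.
  apply/asboolP; rewrite (_ : series _ = cst 0); first exact: is_cvg_cst.
  apply/funext => n; rewrite /series/= big1// => i _.
  by rewrite expr0n/= addr0 sqrtr0 expr0n.
move=> a x y /asboolP cx /asboolP cy; apply/asboolP.
have h := @cvg_lin_bound a _ _ cx cy.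
apply: (series_le_cvg _ _ _ h) => n.
- exact: sqr_ge0.
- rewrite -[leRHS]/(2 * cmod a ^+ 2 * cmod (x n) ^+ 2 + 2 * cmod (y n) ^+ 2).
  by rewrite addr_ge0// ?mulr_ge0// ?cmod_ge0.
- exact: cmod_sqr_lin.
Qed.

HB.instance Definition _ :=
  GRing.isSubmodClosed.Build _ _ square_summable square_summable_submod.

Record ell2 : Type :=
  MkEll2 { coords :> nat -> R[i]; _ : coords \in square_summable }.

HB.instance Definition _ := [isSub for coords].
HB.instance Definition _ := [Choice of ell2 by <:].
HB.instance Definition _ := [SubChoice_isSubLmodule of ell2 by <:].

Definition l2norm (x : ell2) : R :=
  Num.sqrt (limn (series (fun n => cmod (x n) ^+ 2))).

(* Linear in the first argument; the series is summed separately on the real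
   and imaginary parts. *)
Definition l2inner (x y : ell2) : R[i] :=
  limn (series (fun n => complex.Re (x n * (y n)^*%C))) +i*
  limn (series (fun n => complex.Im (x n * (y n)^*%C))).

Lemma l2sum_ge0 (x : ell2) : 0 <= limn (series (fun n => cmod (x n) ^+ 2)).
Proof.
apply: limr_ge; first by apply/asboolP; case: x.
by apply: nearW => n; apply: sumr_ge0 => i _; exact: sqr_ge0.
Qed.

Lemma l2norm_lin (a : R[i]) (u v : ell2) :
  l2norm (a *: u + v) ^+ 2 <= 2 * cmod a ^+ 2 * l2norm u ^+ 2 + 2 * l2norm v ^+ 2.
Proof.
have cvg_sq (x : ell2) : cvgn (series (fun n => cmod (x n) ^+ 2)).
  by apply/asboolP; case: x.
rewrite !sqr_sqrtr ?l2sum_ge0//.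
have -> : 2 * cmod a ^+ 2 * limn (series (fun n => cmod (u n) ^+ 2)) +
    2 * limn (series (fun n => cmod (v n) ^+ 2)) =
    limn (series ((2 * cmod a ^+ 2) *: (fun n => cmod (u n) ^+ 2) +
                2 *: (fun n => cmod (v n) ^+ 2) : R^nat)).
  by rewrite lim_seriesD; [rewrite !lim_seriesZ|exact: is_cvg_seriesZ..].
have h := @cvg_lin_bound a _ _ (cvg_sq u) (cvg_sq v).
apply: (lim_series_le (cvg_sq (a *: u + v)) h).
by move=> n; exact: cmod_sqr_lin.
Qed.

Definition bounded_linear : {pred ell2 -> ell2} :=
  fun A => `[< linear A /\
              exists M : R, forall x, l2norm (A x) <= M * l2norm x >].

Lemma bounded_linear_submod : submod_closed bounded_linear.
Proof.
have n0 : l2norm 0 = 0.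
  rewrite /l2norm (_ : series _ = cst 0) ?lim_cst ?sqrtr0//.
  apply/funext => n; rewrite /series/= big1// => i _.
  by rewrite expr0n/= addr0 sqrtr0 expr0n.
split.
  apply/asboolP; split; first by move=> a u v; rewrite scaler0 addr0.
  by exists 0 => x; rewrite mul0r n0.
move=> a A B /asboolP[lA [M AM]] /asboolP[lB [N BN]]; apply/asboolP; split.
  move=> b u v; rewrite -[LHS]/(a *: A _ + B _) lA lB.
  rewrite -[in RHS]/(b *: (a *: A _ + B _) + (a *: A _ + B _)).
  by rewrite !scalerDr !scalerA [b * a]mulrC !addrA; congr (_ + _); rewrite addrAC.
exists (2 * (cmod a * `|M| + `|N|)) => x.
have l2norm_ge0 : 0 <= l2norm x := sqrtr_ge0 _.
rewrite -[leLHS]ger0_norm ?sqrtr_ge0//.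
rewrite -[leRHS]ger0_norm; last first.
  by rewrite !mulr_ge0// addr_ge0// mulr_ge0// cmod_ge0.
rewrite -ler_sqr ?nnegrE// !real_normK ?num_real//.
apply: (le_trans (l2norm_lin a (A x) (B x))).
have hA : l2norm (A x) ^+ 2 <= `|M| ^+ 2 * l2norm x ^+ 2.
  rewrite -exprMn lerXn2r ?nnegrE ?sqrtr_ge0 ?mulr_ge0//.
  by rewrite (le_trans (AM x))// ler_wpM2r// ler_norm.
have hB : l2norm (B x) ^+ 2 <= `|N| ^+ 2 * l2norm x ^+ 2.
  rewrite -exprMn lerXn2r ?nnegrE ?sqrtr_ge0 ?mulr_ge0//.
  by rewrite (le_trans (BN x))// ler_wpM2r// ler_norm.
apply: (@le_trans _ _ (2 * cmod a ^+ 2 * (`|M| ^+ 2 * l2norm x ^+ 2) +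
    2 * (`|N| ^+ 2 * l2norm x ^+ 2))).
  by apply: lerD; rewrite ler_wpM2l// mulr_ge0// sqr_ge0.
rewrite -subr_ge0 (_ : _ - _ = 2 * ((cmod a * `|M|) ^+ 2 +
  4 * (cmod a * (`|M| * `|N|)) + `|N| ^+ 2) * l2norm x ^+ 2); last by ring.
by rewrite mulr_ge0 ?sqr_ge0// mulr_ge0// !addr_ge0 ?sqr_ge0// !mulr_ge0 ?cmod_ge0.
Qed.

HB.instance Definition _ :=
  GRing.isSubmodClosed.Build _ _ bounded_linear bounded_linear_submod.

(* B(l^2) *)
Record bop : Type := MkBop { op :> ell2 -> ell2; _ : op \in bounded_linear }.

HB.instance Definition _ := [isSub for op].
HB.instance Definition _ := [Choice of bop by <:].
HB.instance Definition _ := [SubChoice_isSubLmodule of bop by <:].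

Definition opnorm (A : bop) : R := sup [set l2norm (A x) | x in [set x | l2norm x <= 1]].

Definition lspan (S : set ell2) : set ell2 :=
  [set x | exists n (c : 'I_n -> R[i]) (v : 'I_n -> ell2),
      (forall i, S (v i)) /\ x = \sum_i c i *: v i].

Definition rank_le (K : bop) (j : nat) : Prop :=
  exists v : 'I_j -> ell2, forall x, lspan (range v) (K x).

Definition sval_nth (j : nat) (A : bop) : R :=
  inf [set opnorm (A - K) | K in [set K | rank_le K j]].

Definition adjoint (A B : bop) : Prop :=
  forall x y, l2inner (A x) y = l2inner x (B y).

Definition schmidt_vector (A : bop) (s : R) (x : ell2) : Prop :=
  x <> 0 /\ exists2 B, adjoint A B & B (A x) = (s ^+ 2)%:C *: x.

Definition schmidt_space (A : bop) (sigma : R) : set ell2 :=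
  lspan [set x | exists j, sigma <= sval_nth j A /\
                           schmidt_vector A (sval_nth j A) x].

End Ell2.

Section FunctionSpaces.
Variable R : realType.
Local Notation T := (circle R).
Local Notation m := (@circle_measure R).

Definition Linfty : set (T -> bop R) :=
  [set F : T -> bop R | (forall x y, cmeasurable (fun z => l2inner (F z x) y)) /\
           (ess_sup m (fun z => (opnorm (F z))%:E) < +oo)%E].

(* Analytic in the open unit disc: sum of a power series converging in norm. *)
Definition disc_analytic (G : R[i] -> bop R) : Prop :=
  exists A : nat -> bop R, forall w : R[i], `|w| < 1 ->
    opnorm (G w - \sum_(k < n) w ^+ k *: A k) @[n --> \oo] --> (0 : R).

Definition disc_bounded (G : R[i] -> bop R) : Prop :=
  exists M : R, forall w : R[i], `|w| < 1 -> opnorm (G w) <= M.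

(* F is the radial limit of G in the strong operator topology, a.e. *)
Definition boundary_values (G : R[i] -> bop R) (F : T -> bop R) : Prop :=
  \forall z \ae m, forall x : ell2 R,
    l2norm (G (r%:C * cval z) x - F z x) @[r --> 1^'-] --> (0 : R).

Definition Hinfty : set (T -> bop R) :=
  [set F | Linfty F /\ exists G,
    [/\ disc_analytic G, disc_bounded G & boundary_values G F]].

Definition L2 : set (T -> ell2 R) :=
  [set f | (forall y, cmeasurable (fun z => l2inner (f z) y)) /\
           (\int[m]_z (l2norm (f z) ^+ 2)%:E < +oo)%E].

(* < f^(k), y >, where f^(k) is the k-th (weak) Fourier coefficient. *)
Definition fourier (f : T -> ell2 R) (k : int) (y : ell2 R) : R[i] :=
  cintegral (fun z => cval z ^ (- k) * l2inner (f z) y).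

Definition H2 : set (T -> ell2 R) :=
  [set f | L2 f /\ forall k : int, k < 0 -> forall y, fourier f k y = 0].

(* g = P_+ f *)
Definition proj_H2 (f g : T -> ell2 R) : Prop :=
  H2 g /\ forall h, H2 h ->
    cintegral (fun z => l2inner (f z - g z) (h z)) = 0.

(* g = T_Phi f; the graph determines g up to a.e. equality. *)
Definition toeplitz (Phi : T -> bop R) (f g : T -> ell2 R) : Prop :=
  H2 f /\ proj_H2 (fun z => Phi z (f z)) g.

Definition ker_toeplitz (Phi : T -> bop R) : set (T -> ell2 R) :=
  [set f | toeplitz Phi f (fun=> 0)].

Definition deviation (Phi : T -> bop R) (j : nat) (F : T -> bop R) : \bar R :=
  if j is 0%N then ess_sup m (fun z => (opnorm (Phi z - F z))%:E)
  else ess_sup m (fun z => (sval_nth j (Phi z - F z))%:E).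

Definition minimizers (S : set (T -> bop R)) (J : (T -> bop R) -> \bar R) :
    set (T -> bop R) :=
  [set F | S F /\ forall G, S G -> (J F <= J G)%E].

(* The class over which the j-th minimization runs: H^oo for j = 0 and
   Omega_(j-1) for j > 0. *)
Fixpoint competitors (Phi : T -> bop R) (j : nat) : set (T -> bop R) :=
  if j is i.+1 then minimizers (competitors Phi i) (deviation Phi i)
  else Hinfty.

Definition Omega (Phi : T -> bop R) (j : nat) : set (T -> bop R) :=
  minimizers (competitors Phi j) (deviation Phi j).

Definition superopt_value (Phi : T -> bop R) (j : nat) : \bar R :=
  ereal_inf [set deviation Phi j F | F in competitors Phi j].

Definition superopt_limit (Phi : T -> bop R) : \bar R :=
  limn (superopt_value Phi).

Definition superopt_approximant (Phi : T -> bop R) : set (T -> bop R) :=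
  \bigcap_j Omega Phi j.

Definition very_badly_approximable (Phi : T -> bop R) : Prop :=
  superopt_approximant Phi (fun=> 0).

Definition condition_C (Phi : T -> bop R) : Prop :=
  forall sigma : R, (superopt_limit Phi < sigma%:E)%E ->
    exists l (xi : 'I_l -> T -> ell2 R),
      (forall i, ker_toeplitz Phi (xi i)) /\
      \forall z \ae m,
        schmidt_space (Phi z) sigma = lspan (range (fun i => xi i z)).

(* The element of L^oo (a class modulo a.e. equality) represented by F. *)
Definition Linfty_class (F : T -> bop R) : set (T -> bop R) :=
  [set G | Linfty G /\ \forall z \ae m, F z = G z].

End FunctionSpaces.

(* Main.v *)
Require Import Defs.
From HB Require Import structures.
From mathcomp Require Import all_boot all_order all_algebra.
From mathcomp Require Import complex.
From mathcomp Require Import all_classical all_reals all_analysis.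
From mathcomp Require Import ess_sup_inf measurable_realfun ring lra.

Set Implicit Arguments.
Unset Strict Implicit.
Unset Printing Implicit Defensive.

Import Order.TTheory GRing.Theory Num.Theory.
Import numFieldTopology.Exports numFieldNormedType.Exports.

Local Open Scope classical_set_scope.
Local Open Scope ring_scope.
Local Open Scope complex_scope.

(* Take Phi(z) = diag(0, conj z, conj z, ...).  If F is bounded analytic and
   |Phi - F| <= 1 a.e., then a diagonal entry g of F away from the corner
   satisfies |1 - z g| <= 1, that is |g|^2 <= 2 Re (z g); since z g has mean 0,
   g = 0.  The corresponding column of Phi - F then has an entry conj z of
   modulus 1 and norm at most 1, so all its other entries vanish.  Hence
   Phi - F is isometric on an infinite-dimensional subspace, all its singular
   values are at least 1, and t_j(Phi) = 1 for every j.  The corner entry is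
   free: every constant diag(c, 0, 0, ...) with |c| <= 1 is a superoptimal
   approximant. *)

(** * Norms and coordinates in [ell2], operator norms, diagonal operators *)

Section Ell2Theory.
Variable R : realType.
Implicit Types (x y : ell2 R) (A B : bop R) (a : R[i]).

Lemma cvg_l2series x : cvgn (series (fun n => cmod (x n) ^+ 2)).
Proof. by apply/asboolP; case: x. Qed.

Lemma l2norm_ge0 x : 0 <= l2norm x.
Proof. exact: sqrtr_ge0. Qed.

Lemma sqr_l2norm x : l2norm x ^+ 2 = limn (series (fun n => cmod (x n) ^+ 2)).
Proof. by rewrite sqr_sqrtr// l2sum_ge0. Qed.

Lemma sum_sqr_cmod_le x N : \sum_(i < N) cmod (x i) ^+ 2 <= l2norm x ^+ 2.
Proof.
rewrite sqr_l2norm -(big_mkord xpredT (fun i => cmod (x i) ^+ 2)).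
rewrite -[leLHS]/(series (fun n => cmod (x n) ^+ 2) N).
apply: nondecreasing_cvgn_le; last exact: cvg_l2series.
by apply/nondecreasing_seqP => n; rewrite /series/= big_nat_recr//= lerDl sqr_ge0.
Qed.

Lemma cmod_coord_le x n : cmod (x n) <= l2norm x.
Proof.
rewrite -(@ler_pXn2r _ 2)// ?nnegrE ?l2norm_ge0 ?cmod_ge0//.
apply: le_trans (sum_sqr_cmod_le x n.+1).
by rewrite big_ord_recr/= lerDr sumr_ge0// => i _; exact: sqr_ge0.
Qed.

(** Serves later for a column of norm at most 1: one entry of modulus 1 forces all other entries to
    vanish. *)
Lemma sqr_cmod_coord2_le x n k : n != k ->
  cmod (x n) ^+ 2 + cmod (x k) ^+ 2 <= l2norm x ^+ 2.
Proof.
wlog nk : n k / (n < k)%N => [wl|_].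
  rewrite neq_ltn => /orP[] h; first by apply: wl; rewrite // ltn_eqF.
  by rewrite addrC; apply: wl => //; rewrite ltn_eqF.
apply: le_trans (sum_sqr_cmod_le x k.+1).
rewrite big_ord_recr/= lerD2r (bigD1 (Ordinal nk))//= lerDl.
by apply: sumr_ge0 => i _; exact: sqr_ge0.
Qed.

Lemma ell2P x y : (forall n, x n = y n) -> x = y.
Proof. by move=> xy; apply/val_inj/funext => n; exact: xy. Qed.

Lemma l2norm_eq0 x : l2norm x = 0 -> x = 0.
Proof.
move=> x0; apply: ell2P => n; apply: Normc.eq0_normc; apply/eqP.
by rewrite eq_le cmod_ge0 -x0 cmod_coord_le.
Qed.

Lemma le_l2norm x y (c : R) : 0 <= c ->
  (forall n, cmod (y n) <= c * cmod (x n)) -> l2norm y <= c * l2norm x.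
Proof.
move=> c0 yx; rewrite -(@ler_pXn2r _ 2)// ?nnegrE ?mulr_ge0 ?l2norm_ge0//.
rewrite exprMn !sqr_l2norm.
have <- : limn (series ((c ^+ 2) *: (fun n => cmod (x n) ^+ 2) : R^nat)) =
  c ^+ 2 * limn (series (fun n => cmod (x n) ^+ 2)).
  by rewrite lim_seriesZ//; exact: cvg_l2series.
apply: lim_series_le; [exact: cvg_l2series| |].
  by apply: is_cvg_seriesZ; exact: cvg_l2series.
move=> n; rewrite -[leRHS]/(c ^+ 2 * cmod (x n) ^+ 2) -exprMn lerXn2r//.
  by rewrite nnegrE cmod_ge0.
by rewrite nnegrE mulr_ge0// cmod_ge0.
Qed.

Lemma cmod0 : cmod (0 : R[i]) = 0.
Proof. exact: Normc.normc0. Qed.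

Lemma l2norm0 : l2norm (0 : ell2 R) = 0.
Proof.
apply/eqP; rewrite eq_le l2norm_ge0 andbT.
by rewrite -[leRHS](mul0r (l2norm 0)) le_l2norm// => n; rewrite mul0r cmod0.
Qed.

Lemma coordsZ a x n : (a *: x) n = a * x n. Proof. by []. Qed.

Lemma coords_sum (I : Type) (r : seq I) (f : I -> ell2 R) n :
  (\sum_(i <- r) f i) n = \sum_(i <- r) f i n.
Proof. by elim/big_ind2 : _ => // x1 x2 y1 y2 <- <-. Qed.

Lemma l2normZ_le a x : l2norm (a *: x) <= cmod a * l2norm x.
Proof. by apply: le_l2norm (cmod_ge0 _) _ => n; rewrite Normc.normcM. Qed.

(** The reverse inequality is [l2normZ_le] for the scalar [a^-1] and the vector [a *: x]. *)
Lemma l2normZ a x : l2norm (a *: x) = cmod a * l2norm x.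
Proof.
apply/eqP; rewrite eq_le l2normZ_le/=.
have [->|a0] := eqVneq a 0; first by rewrite cmod0 mul0r l2norm_ge0.
have := l2normZ_le a^-1 (a *: x); rewrite scalerA mulVf// scale1r.
have ca : 0 < cmod a.
  rewrite lt_neqAle cmod_ge0 andbT eq_sym; apply: contra a0 => /eqP.
  by move/Normc.eq0_normc ->.
have -> : cmod a^-1 = (cmod a)^-1.
  apply: (mulfI (lt0r_neq0 ca)); rewrite mulfV ?lt0r_neq0//.
  by rewrite -Normc.normcM mulfV// Normc.normc1.
by rewrite -ler_pdivlMl// invrK.
Qed.

Lemma delta_subproof n :
  (fun k => ((k == n)%:R : R[i])) \in @square_summable R.
Proof.
apply/asboolP; apply/cvg_ex; exists 1; apply: cvg_near_cst.
exists n.+1 => // k /= nk; rewrite /series/= big_mkord.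
rewrite (bigD1 (Ordinal nk))//= eqxx Normc.normc1 expr1n big1 ?addr0//.
move=> i; rewrite -val_eqE/= => /negbTE ->.
by rewrite Normc.normc0 expr0n.
Qed.

Definition delta n : ell2 R := MkEll2 (delta_subproof n).

Lemma deltaE n k : delta n k = (k == n)%:R. Proof. by []. Qed.

Lemma l2norm_delta n : l2norm (delta n) = 1.
Proof.
apply/eqP; rewrite eq_le; apply/andP; split; last first.
  by rewrite (le_trans _ (cmod_coord_le _ n))// deltaE eqxx Normc.normc1.
rewrite -(@ler_pXn2r _ 2)// ?nnegrE ?l2norm_ge0// sqr_l2norm expr1n.
apply: limr_le; first exact: cvg_l2series.
apply: nearW => N; rewrite /series/= big_mkord.
have [nN|Nn] := ltnP n N.
  rewrite (bigD1 (Ordinal nN))//= eqxx Normc.normc1 expr1n big1 ?addr0//.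
  move=> i; rewrite -val_eqE/= => /negbTE ->.
  by rewrite Normc.normc0 expr0n.
rewrite big1 ?ler01// => i _; rewrite ltn_eqF ?(leq_trans _ Nn)//.
by rewrite Normc.normc0 expr0n.
Qed.

Lemma op_linear A : linear A.
Proof. by case: A => f /= /asboolP[]. Qed.

Lemma op_bounded A : exists M : R, forall x, l2norm (A x) <= M * l2norm x.
Proof. by case: A => f /= /asboolP[]. Qed.

Lemma op_sum A (I : Type) (r : seq I) (f : I -> R[i]) (v : I -> ell2 R) :
  A (\sum_(i <- r) f i *: v i) = \sum_(i <- r) f i *: A (v i).
Proof.
have A0 : A 0 = 0.
  (* The scalar -1 at the zero vector gives [A 0 = - A 0 + A 0]. *)
  have := op_linear A (-1) 0 0; rewrite scaler0 addr0 => {1}->.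
  by rewrite scaleN1r addNr.
elim: r => [|i r ih]; first by rewrite !big_nil.
by rewrite !big_cons op_linear ih.
Qed.

Lemma opZ A a x : A (a *: x) = a *: A x.
Proof. by have := op_sum A [:: tt] (fun=> a) (fun=> x); rewrite !big_seq1. Qed.

Lemma op0 A : A 0 = 0.
Proof. by rewrite -[X in A X](scale0r 0) opZ scale0r. Qed.

(** [opnorm] is a real [sup], which is meaningful only for a nonempty set that is bounded above. *)
Lemma opnorm_has_sup A : has_sup [set l2norm (A x) | x in [set x | l2norm x <= 1]].
Proof.
split; first by exists (l2norm (A 0)), 0 => //=; rewrite l2norm0.
(* The bound [M] comes without a sign, hence the absolute value. *)
have [M AM] := op_bounded A; exists `|M| => _ [x /= x1 <-].
rewrite (le_trans (AM x))// (le_trans (ler_wpM2r (l2norm_ge0 _) (ler_norm M)))//.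
by rewrite ler_piMr.
Qed.

Lemma opnorm_ge A x : l2norm x <= 1 -> l2norm (A x) <= opnorm A.
Proof. by move=> x1; apply: sup_ubound (opnorm_has_sup A).2 _ _; exists x. Qed.

Lemma opnorm_ge0 A : 0 <= opnorm A.
Proof. by rewrite -[leLHS]l2norm0 -(op0 A) opnorm_ge// l2norm0. Qed.

Lemma opnorm_le A (M : R) : 0 <= M -> (forall x, l2norm (A x) <= M * l2norm x) ->
  opnorm A <= M.
Proof.
move=> M0 AM; apply: ge_sup (opnorm_has_sup A).1 _ => _ [x /= x1 <-].
by rewrite (le_trans (AM x))// ler_piMr.
Qed.

Lemma le_opnorm A x : l2norm (A x) <= opnorm A * l2norm x.
Proof.
have [/l2norm_eq0 ->|x0] := eqVneq (l2norm x) 0; first by rewrite op0 !l2norm0 mulr0.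
have px : 0 < l2norm x by rewrite lt_neqAle eq_sym x0 l2norm_ge0.
have cV : cmod ((l2norm x)^-1)%:C = (l2norm x)^-1.
  by rewrite /= expr0n/= addr0 sqrtr_sqr ger0_norm// invr_ge0 ltW.
have := @opnorm_ge A ((l2norm x)^-1%:C *: x).
by rewrite opZ !l2normZ cV mulVf// ler_pdivrMl// mulrC; apply.
Qed.

Lemma cmod_entry_le A n k : cmod (A (delta n) k) <= opnorm A.
Proof.
by rewrite (le_trans (cmod_coord_le _ _))// opnorm_ge// l2norm_delta.
Qed.

Lemma diag_subproof1 (a : nat -> R[i]) (M : R) (aM : forall n, cmod (a n) <= M) x :
  (fun n => a n * x n) \in @square_summable R.
Proof.
have M0 : 0 <= M := le_trans (cmod_ge0 _) (aM 0%N).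
apply/asboolP.
have h : cvgn (series ((M ^+ 2) *: (fun n => cmod (x n) ^+ 2) : R^nat)).
  by apply: is_cvg_seriesZ; exact: cvg_l2series.
apply: (series_le_cvg _ _ _ h) => n; rewrite ?sqr_ge0//.
  by rewrite mulr_ge0// sqr_ge0.
rewrite -[leRHS]/(M ^+ 2 * cmod (x n) ^+ 2) -exprMn Normc.normcM lerXn2r//.
- by rewrite nnegrE mulr_ge0// cmod_ge0.
- by rewrite nnegrE mulr_ge0// cmod_ge0.
- by rewrite ler_wpM2r// cmod_ge0.
Qed.

Lemma diag_subproof2 (a : nat -> R[i]) (M : R) (aM : forall n, cmod (a n) <= M) :
  (fun x => MkEll2 (diag_subproof1 aM x)) \in @bounded_linear R.
Proof.
have M0 : 0 <= M := le_trans (cmod_ge0 _) (aM 0%N).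
apply/asboolP; split.
  by move=> b x y; apply/val_inj/funext => n /=; rewrite mulrDr mulrCA.
exists M => x; apply: le_l2norm => // n.
by rewrite /= Normc.normcM ler_wpM2r// cmod_ge0.
Qed.

Definition diag_op (a : nat -> R[i]) (M : R) (aM : forall n, cmod (a n) <= M) : bop R :=
  MkBop (diag_subproof2 aM).

Lemma diag_opE (a : nat -> R[i]) (M : R) (aM : forall n, cmod (a n) <= M) x n :
  diag_op aM x n = a n * x n.
Proof. by []. Qed.

End Ell2Theory.

(** * Finite-rank operators and lower bounds for singular values *)

Section SingularValues.
Variable R : realType.
Implicit Types (x y : ell2 R) (A B K : bop R) (a : R[i]).

Lemma rank_le0 j : rank_le (0 : bop R) j.
Proof.
exists (fun=> 0) => x; exists 0%N, (fun=> 0), (fun=> 0); split; first by case.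
by rewrite big_ord0.
Qed.

Lemma sval_nth_le_opnorm j A : sval_nth j A <= opnorm A.
Proof.
apply: ge_inf; first by exists 0 => _ [K _ <-]; exact: opnorm_ge0.
by exists 0; [exact: rank_le0|rewrite subr0].
Qed.

(** A combination of elements of the range may use one [v k] several times; adding the coefficients
    over each fibre of the index map [f] leaves one coefficient per index. *)
Lemma lspan_range j (v : 'I_j -> ell2 R) x : lspan (range v) x ->
  exists c : 'I_j -> R[i], x = \sum_i c i *: v i.
Proof.
case=> n [c [w [wv ->]]].
have /choice[f fw] : forall i, exists k, v k = w i.
  by move=> i; have [k _ <-] := wv i; exists k.
exists (fun k => \sum_(i | f i == k) c i).
rewrite (partition_big f xpredT)//=; apply: eq_bigr => k _.
by rewrite scaler_suml; apply: eq_bigr => i /eqP <-; rewrite fw.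
Qed.

(** Dimension count: the images of j + 1 vectors lie in the span of j vectors, so they satisfy a
    nontrivial linear relation. *)
Lemma rank_le_kernel j K (u : 'I_j.+1 -> ell2 R) : rank_le K j ->
  exists2 c : 'I_j.+1 -> R[i], (exists i, c i != 0) & K (\sum_i c i *: u i) = 0.
Proof.
case=> v Kv; have /choice[d Kd] : forall i, exists c : 'I_j -> R[i],
    K (u i) = \sum_k c k *: v k by move=> i; exact: lspan_range.
(* Row i holds the coordinates of [K (u i)]. With more rows than columns, [M] has a nonzero left
   kernel, and a nonzero row of [kermx M] is the relation sought. *)
pose M : 'M[R[i]]_(j.+1, j) := \matrix_(i, k) d i k.
have kM : kermx M != 0.
  rewrite -mxrank_eq0 mxrank_ker subn_eq0 -ltnNge.
  by rewrite (leq_ltn_trans (rank_leq_col M)).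
have [i rM] : exists i, row i (kermx M) != 0.
  apply/existsP; apply: contraNT kM => /existsPn h.
  by apply/eqP/row_matrixP => i; rewrite row0; apply/eqP; have := h i; rewrite negbK.
exists (fun k => row i (kermx M) 0 k).
  by have [k rk] := rV0Pn _ rM; exists k.
rewrite op_sum; under eq_bigr do rewrite Kd scaler_sumr.
rewrite exchange_big/= big1// => k _.
have := congr1 (fun N : 'rV_j => N 0 k) (sub_kermxP (row_sub i (kermx M))).
rewrite !mxE => h; rewrite -[RHS](scale0r (v k)) -h scaler_suml.
by apply: eq_bigr => l _; rewrite scalerA [M _ _]mxE.
Qed.

(** On the span of the basis vectors 1, ..., j + 1 the operator [A] is multiplication by the
    unimodular [lam]. An operator [K] of rank at most j kills some nonzero x there, so [A - K]
    preserves the norm of x. *)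
Lemma sval_nth_ge1 j A (lam : R[i]) : cmod lam = 1 ->
  (forall n, A (delta R n.+1) = lam *: delta R n.+1) -> 1 <= sval_nth j A.
Proof.
move=> lam1 Alam; apply: lb_le_inf.
  by exists (opnorm (A - 0)), 0 => //; exact: rank_le0.
move=> _ [K /= rK <-].
have [c [i ci] Kx] := rank_le_kernel (fun i : 'I_j.+1 => delta R i.+1) rK.
move: Kx; set x := \sum_i _ => Kx.
(* The coordinates of x recover the coefficients, so x is nonzero. *)
have xi : x i.+1 = c i.
  rewrite coords_sum (bigD1 i)// big1 => [|k ki].
    by rewrite [LHS]addr0 coordsZ deltaE eqxx mulr1.
  rewrite coordsZ deltaE eqSS -[(_ == _ :> nat)]/(i == k) eq_sym.
  by rewrite (negbTE ki) mulr0.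
have Ax : (A - K) x = lam *: x.
  rewrite -[LHS]/(A x - K x) Kx subr0 op_sum scaler_sumr.
  by apply: eq_bigr => k _; rewrite Alam !scalerA mulrC.
have x0 : 0 < l2norm x.
  rewrite lt_neqAle l2norm_ge0 andbT eq_sym; apply: contra ci => /eqP/l2norm_eq0 x0.
  by rewrite -xi x0.
have := le_opnorm (A - K) x; rewrite Ax l2normZ lam1 mul1r.
by rewrite -{1}[l2norm x]mul1r ler_pM2r.
Qed.

End SingularValues.

(** * Integrals of monomials over the circle *)

Section CircleIntegrals.
Variable R : realType.
Local Notation T := (circle R).
Local Notation m := (@circle_measure R).

Lemma circle_measureT : m setT = 1%E.
Proof. by rewrite /circle_measure /pushforward preimage_setT probability_setT. Qed.

Lemma cmod_circle (z : T) : cmod (cval z) = 1.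
Proof. by case: z => z /= /eqP; rewrite normc_def; case: z => a b /= [->]. Qed.

Lemma conj_circle (z : T) : (cval z)^*%C * cval z = 1.
Proof.
case: z => z /= /eqP; rewrite normc_def; case: z => a b /= [] h.
have : a ^+ 2 + b ^+ 2 = 1.
  by rewrite -[LHS]sqr_sqrtr ?h ?expr1n// addr_ge0// sqr_ge0.
by move=> {}h; apply/eqP; rewrite eq_complex/=; apply/andP; split; apply/eqP;
  [rewrite -h|]; ring.
Qed.

(** A set in the circle is measurable exactly when its preimage under [expi] is, so measurability
    can be tested on the angle. *)
Lemma measurable_circleP (f : T -> R) :
  measurable_fun setT (fun t : measurableTypeR R => f (expi t)) -> measurable_fun setT f.
Proof.
by move=> mf _ A mA; have := mf measurableT A mA; rewrite !setTI.
Qed.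

(** De Moivre's formula. *)
Lemma expiX (t : R) k : (cval (expi t)) ^+ k = cos (k%:R * t) +i* sin (k%:R * t).
Proof.
elim: k => [|k ih]; first by rewrite mul0r cos0 sin0.
rewrite exprS ih -natr1 mulrDl mul1r cosD sinD /=.
by apply/eqP; rewrite eq_complex/=; apply/andP; split; apply/eqP; ring.
Qed.

Lemma Re_monomial_expi (a : R[i]) k (t : R) :
  complex.Re (a * cval (expi t) ^+ k) =
  complex.Re a * cos (k%:R * t) - complex.Im a * sin (k%:R * t).
Proof. by rewrite expiX; case: a. Qed.

Lemma continuous_cosM (k : R) : continuous (fun t : R => cos (k * t)).
Proof.
move=> t; apply: (@continuous_comp _ _ _ (fun t => k * t) cos).
  exact: mulrl_continuous.
exact: continuous_cos.
Qed.

Lemma continuous_sinM (k : R) : continuous (fun t : R => sin (k * t)).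
Proof.
move=> t; apply: (@continuous_comp _ _ _ (fun t => k * t) sin).
  exact: mulrl_continuous.
exact: continuous_sin.
Qed.

Lemma measurable_Re_monomial (a : R[i]) k :
  measurable_fun setT (fun z : T => complex.Re (a * cval z ^+ k)).
Proof.
apply: measurable_circleP; under eq_fun do rewrite Re_monomial_expi.
apply: measurable_funB; apply: measurable_funM => //.
- exact (continuous_measurable_fun (@continuous_cosM k%:R)).
- exact (continuous_measurable_fun (@continuous_sinM k%:R)).
Qed.

Lemma normr_Re_le (w : R[i]) : `|complex.Re w| <= cmod w.
Proof.
case: w => a b /=; rewrite -sqrtr_sqr ler_wsqrtr// lerDl; exact: sqr_ge0.
Qed.

Lemma normr_Im_le (w : R[i]) : `|complex.Im w| <= cmod w.
Proof.
case: w => a b /=; rewrite -sqrtr_sqr ler_wsqrtr// lerDr; exact: sqr_ge0.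
Qed.

Lemma normr_Re_monomial_le (a : R[i]) k (z : T) :
  `|complex.Re (a * cval z ^+ k)| <= cmod a.
Proof.
rewrite (le_trans (normr_Re_le _))// Normc.normcM.
have -> : cmod (cval z ^+ k) = 1.
  elim: k => [|k ih]; first by rewrite expr0 Normc.normc1.
  by rewrite exprS Normc.normcM cmod_circle mul1r.
by rewrite mulr1.
Qed.

Lemma bounded_circle_integrable (f : T -> R) (M : R) :
  measurable_fun setT f -> (forall z, `|f z| <= M) -> m.-integrable setT (EFin \o f).
Proof.
move=> mf fM; apply: measurable_bounded_integrable => //.
  by rewrite [ltLHS]circle_measureT ltry.
exists M; split; first exact: num_real.
by move=> x /ltW Mx z _; exact: le_trans (fM z) Mx.
Qed.

Lemma integral_circle_cst (c : R) : (\int[m]_z (c%:E) = c%:E)%E.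
Proof. by rewrite integral_cst// [X in (_ * X)%E]circle_measureT mule1. Qed.

(* The integrals over R and over the circle are compared by integral_uniform,
   which needs a nonnegative integrand: hence the shift by |a|. *)
Lemma integral_Re_monomial (a : R[i]) k :
  (\int[m]_z (complex.Re (a * cval z ^+ k.+1))%:E = 0)%E.
Proof.
pose C := cmod a; pose f (z : T) : R := complex.Re (a * cval z ^+ k.+1).
have fC z : `|f z| <= C by exact: normr_Re_monomial_le.
have mf : measurable_fun setT f by exact: measurable_Re_monomial.
have fi := bounded_circle_integrable mf fC.
have Ci : m.-integrable setT (EFin \o cst C).
  by apply: (@bounded_circle_integrable _ `|C|).
have Cf0 z : 0 <= C + f z.
  by have := fC z; rewrite ler_norml => /andP[+ _]; rewrite -subr_ge0 opprK addrC.
have mCf : measurable_fun setT (fun z => C + f z).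
  exact: measurable_funD.
suff : (\int[m]_z (C + f z)%:E = C%:E)%E.
  under eq_integral do rewrite EFinD.
  rewrite (integralD measurableT Ci fi) [X in (X + _)%E]integral_circle_cst.
  have /integrable_fin_num := fi => /(_ measurableT).
  by case: (\int[m]_z _)%E => // r _ [] Cr; congr (_%:E); lra.
rewrite [LHS]ge0_integral_pushforward//; last 3 first.
- exact: measurable_expi.
- exact/measurable_EFinP.
- by move=> z _; rewrite lee_fin.
rewrite preimage_setT/= integral_uniform//; last 2 first.
- apply/measurable_EFinP.
  exact (measurableT_comp mCf (@measurable_expi R)).
- by move=> t; rewrite lee_fin.
(* An antiderivative of [C + f (expi t)]; it exists in this form because the exponent [k.+1] is
   nonzero. *)
pose F (t : R) : R := C * t +
  (complex.Re a * sin (k.+1%:R * t) + complex.Im a * cos (k.+1%:R * t)) / k.+1%:R.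
have kn0 : k.+1%:R != 0 :> R by rewrite pnatr_eq0.
have dk (t : R) : is_derive t (1 : R) (fun t : R => k.+1%:R * t) k.+1%:R.
  by apply: is_derive_eq; exact: mulr1.
have dF (t : R) : is_derive t (1 : R) F (C + f (expi t)).
  rewrite /f Re_monomial_expi.
  have ds : is_derive t (1 : R) (fun t : R => sin (k.+1%:R * t))
      (cos (k.+1%:R * t) * k.+1%:R).
    exact: (@is_derive1_comp R sin).
  have dc : is_derive t (1 : R) (fun t : R => cos (k.+1%:R * t))
      (- sin (k.+1%:R * t) * k.+1%:R).
    exact: (@is_derive1_comp R cos).
  rewrite /F; apply: is_derive_eq.
  rewrite scaler0 scaler0 add0r [C%:A]mulr1; congr (_ + _).
  rewrite -![_ *: _]/(_ * _).
  by move: (k.+1%:R) kn0 => K K0; field.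
have cf : {within `[0, pi *+ 2], continuous (fun t : R => C + f (expi t))}.
  apply: continuous_subspaceT => t; rewrite /f.
  under eq_fun do rewrite Re_monomial_expi.
  apply: (@cvgD _ _ _ _ _ (cst C)); first exact: cvg_cst.
  apply: cvgB; apply: cvgM; try exact: cvg_cst.
    exact: continuous_cosM.
  exact: continuous_sinM.
have dF' : derivable_oo_LRcontinuous F 0 (pi *+ 2).
  have cF : continuous F by move=> t; apply/differentiable_continuous/derivable1_diffP.
  split; [by move=> t _|apply: cvg_at_right_filter; exact: cF|
    apply: cvg_at_left_filter; exact: cF].
rewrite (continuous_FTC2 (twopi_gt0 R) cf dF'); last first.
  by move=> t _; rewrite derive1E; exact: derive_val.
(* The angle at the right end is written as 0 plus [k.+1] periods, so the trigonometric terms at the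
   two ends cancel and only C times the length of the interval remains. *)
rewrite /F !mulr0 sin0 cos0 mulr_natl -[_ *+ k.+1]add0r.
rewrite (periodicn (@sinD2pi R)) (periodicn (@cosD2pi R)) sin0 cos0 add0r subr0.
rewrite -EFinB -EFinM; congr (_%:E).
have := twopi_gt0 R; move: (pi *+ 2) => p p0; rewrite addrK mulrCA mulVf ?mulr1//.
by rewrite gt_eqF.
Qed.

End CircleIntegrals.

(** * Mean values of bounded analytic functions *)

Section HardyMean.
Variable R : realType.
Local Notation T := (circle R).
Local Notation m := (@circle_measure R).

Lemma cmodN (w : R[i]) : cmod (- w) = cmod w.
Proof. by case: w => a b /=; rewrite !sqrrN. Qed.

Lemma cmodX (w : R[i]) k : cmod (w ^+ k) = cmod w ^+ k.
Proof.
by elim: k => [|k ih]; rewrite ?expr0 ?Normc.normc1// !exprS Normc.normcM ih.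
Qed.

Lemma cmod_real (r : R) : 0 <= r -> cmod r%:C = r.
Proof. by move=> r0; rewrite /= expr0n/= addr0 sqrtr_sqr ger0_norm. Qed.

Lemma disc_lt1 (w : R[i]) : (`|w| < 1) = (cmod w < 1).
Proof. by rewrite normc_def; case: w => a b /=; rewrite ltcR. Qed.

Lemma Re_sum (I : Type) (s : seq I) (f : I -> R[i]) :
  complex.Re (\sum_(i <- s) f i) = \sum_(i <- s) complex.Re (f i).
Proof. by apply: (big_morph (@complex.Re R)) => // -[a b] [c d]. Qed.

Lemma normr_Re_circleB_le (z : T) (u v : R[i]) :
  `|complex.Re (cval z * u) - complex.Re (cval z * v)| <= cmod (u - v).
Proof.
have -> : complex.Re (cval z * u) - complex.Re (cval z * v) =
    complex.Re (cval z * (u - v)).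
  by rewrite mulrBr; case: (_ * _) => ? ?; case: (_ * _).
by rewrite (le_trans (normr_Re_le _))// Normc.normcM cmod_circle mul1r.
Qed.

(** Scalar counterpart of [disc_analytic]: only convergence of the partial sums is asked; absolute
    bounds at smaller radii are derived from it. *)
Definition power_series (a : nat -> R[i]) (h : R[i] -> R[i]) : Prop :=
  forall w, `|w| < 1 ->
    cmod (h w - \sum_(k < n) w ^+ k * a k) @[n --> \oo] --> (0 : R).

(** Abel's argument: at a radius s strictly between r and 1 the terms are bounded, so at r they are
    dominated by a geometric series of ratio r / s. *)
Lemma power_series_abs_bounded a h (r : R) : power_series a h -> 0 <= r -> r < 1 ->
  exists M : R, forall n, \sum_(k < n) r ^+ k * cmod (a k) <= M.
Proof.
move=> ah r0 r1; pose s := (1 + r) / 2.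
have s0 : 0 < s by rewrite /s; lra.
have s1 : s < 1 by rewrite /s; lra.
have rs : r < s by rewrite /s; lra.
have /ah hs : `|s%:C| < 1 by rewrite disc_lt1 cmod_real// ltW.
have [M [Mr Mb]] := cvg_seq_bounded (cvgP _ hs).
(* [cvg_seq_bounded] yields a bound by every number exceeding [M]; [|M| + 1] is one. *)
have {}Mb n : cmod (h s%:C - \sum_(k < n) s%:C ^+ k * a k) <= `|M| + 1.
  have := Mb (`|M| + 1); rewrite (le_lt_trans (ler_norm M)) ?ltrDl// => /(_ isT n I).
  by rewrite [X in X <= _ -> _]ger0_norm ?cmod_ge0.
pose C := (`|M| + 1) * 2.
have aC k : s ^+ k * cmod (a k) <= C.
  have -> : s ^+ k * cmod (a k) = cmod (s%:C ^+ k * a k).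
    by rewrite Normc.normcM cmodX cmod_real// ltW.
  (* A term is the difference of two consecutive remainders, each at most [|M| + 1]; hence the
     factor 2 in [C]. *)
  have -> : s%:C ^+ k * a k = (h s%:C - \sum_(i < k) s%:C ^+ i * a i)
      - (h s%:C - \sum_(i < k.+1) s%:C ^+ i * a i).
    by rewrite big_ord_recr/=; ring.
  by rewrite (le_trans (le_normcD _ _))// cmodN /C mulr_natr mulr2n lerD.
have q1 : 0 < 1 - r / s by rewrite subr_gt0 ltr_pdivrMr// mul1r.
have q0 : 0 <= r / s by rewrite divr_ge0// ltW.
exists (C / (1 - r / s)) => n.
apply: (@le_trans _ _ (\sum_(k < n) C * (r / s) ^+ k)).
  apply: ler_sum => k _; rewrite -{1}[r](divfK (lt0r_neq0 s0)) exprMn -mulrA mulrC.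
  by rewrite ler_wpM2r// exprn_ge0.
rewrite -mulr_sumr ler_wpM2l//.
  by rewrite /C mulr_ge0// addr_ge0.
rewrite -[leRHS]mul1r ler_pdivlMr// mulrC.
have -> : (1 - r / s) * \sum_(k < n) (r / s) ^+ k = 1 - (r / s) ^+ n.
  by rewrite -opprB mulNr -subrX1 opprB.
by rewrite lerBlDr lerDl exprn_ge0.
Qed.

(** [z h(r z)] is the sum of the terms [r^k a_k z^(k+1)], whose real parts have mean zero thanks to
    the extra factor z. The absolute bound on the partial sums allows dominated convergence. *)
Lemma power_series_circle_mean a h (r : R) : power_series a h -> 0 <= r -> r < 1 ->
  measurable_fun setT (fun z : T => complex.Re (cval z * h (r%:C * cval z))) /\
  (\int[m]_z (complex.Re (cval z * h (r%:C * cval z)))%:E = 0)%E.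
Proof.
move=> ah r0 r1; have [M aM] := power_series_abs_bounded ah r0 r1.
pose p n (z : T) : R := \sum_(k < n) complex.Re (r%:C ^+ k * a k * cval z ^+ k.+1).
have pE n z : p n z = complex.Re (cval z * \sum_(k < n) (r%:C * cval z) ^+ k * a k).
  rewrite /p -Re_sum mulr_sumr; congr complex.Re; apply: eq_bigr => k _.
  by rewrite exprMn exprS; ring.
have mp n : measurable_fun setT (p n).
  by apply: measurable_sum => k; exact: measurable_Re_monomial.
have pM n z : `|p n z| <= M.
  rewrite (le_trans _ (aM n))// (le_trans (ler_norm_sum _ _ _))//.
  apply: ler_sum => k _; rewrite (le_trans (normr_Re_monomial_le _ _ _))//.
  by rewrite Normc.normcM cmodX cmod_real.
have ip n : (\int[m]_z (p n z)%:E = 0)%E.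
  under eq_integral do rewrite /p -sumEFin.
  rewrite integral_sum//; first by rewrite big1// => k _; exact: integral_Re_monomial.
  move=> k; apply: (@bounded_circle_integrable _ _ (cmod (r%:C ^+ k * a k))).
    exact: measurable_Re_monomial.
  by move=> z; exact: normr_Re_monomial_le.
have cp z : p n z @[n --> \oo] --> complex.Re (cval z * h (r%:C * cval z)).
  have /ah hz : `|r%:C * cval z| < 1.
    by rewrite disc_lt1 Normc.normcM cmod_circle mulr1 cmod_real.
  apply/cvgrPdist_le => e e0.
  have /cvgrPdist_le /(_ e e0) := hz; apply: filterS => n.
  rewrite sub0r normrN ger0_norm ?cmod_ge0// => le_e.
  rewrite pE.
  exact: le_trans (normr_Re_circleB_le _ _ _) le_e.
have mh : measurable_fun setT (fun z : T => complex.Re (cval z * h (r%:C * cval z))).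
  exact: (measurable_fun_cvg mp (fun z _ => cp z)).
split => //.
have [|||||_ _] := @dominated_convergence _ _ _ m setT measurableT
  (fun n z => (p n z)%:E) (fun z => (complex.Re (cval z * h (r%:C * cval z)))%:E)
  (fun=> M%:E).
- by move=> n; exact/measurable_EFinP.
- exact/measurable_EFinP.
- by apply: nearW => z _; apply: cvg_EFin; [exact: nearW|exact: cp].
- apply: (@bounded_circle_integrable _ (cst M) `|M|) => //.
- by apply: nearW => z n _; rewrite lee_fin.
rewrite (_ : [sequence _]_n = cst 0%E); last by apply/funext => n; exact: ip.
by move=> /cvg_lim <-//; rewrite lim_cst.
Qed.

(** The means at radii r < 1 vanish. As r tends to 1, the bound on h dominates and the radial limits
    give pointwise convergence. *)
Lemma hardy_mean a h (g : T -> R[i]) (M : R) : power_series a h ->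
  (forall w, `|w| < 1 -> cmod (h w) <= M) ->
  (\forall z \ae m, cmod (h (r%:C * cval z) - g z) @[r --> 1^'-] --> (0 : R)) ->
  measurable_fun setT (fun z : T => complex.Re (cval z * g z)) ->
  (\int[m]_z (complex.Re (cval z * g z))%:E = 0)%E.
Proof.
move=> ah hM hg mg.
(* Dominated convergence needs a sequence of radii; this one starts at 0 and stays below 1. *)
pose r_ (n : nat) : R := 1 - n.+1%:R^-1.
have r0 n : 0 <= r_ n by rewrite subr_ge0 invf_le1// ler1n.
have r1 n : r_ n < 1 by rewrite ltrBlDr ltrDl invr_gt0.
have cr : r_ n @[n --> \oo] --> (1 : R).
  by rewrite -[X in _ --> X]subr0; apply: cvgB; [exact: cvg_cst|exact: cvg_harmonic].
have [|||||_ _] := @dominated_convergence _ _ _ m setT measurableT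
  (fun n z => (complex.Re (cval z * h ((r_ n)%:C * cval z)))%:E)
  (fun z => (complex.Re (cval z * g z))%:E) (fun=> M%:E).
- by move=> n; apply/measurable_EFinP; case: (power_series_circle_mean ah (r0 n) (r1 n)).
- exact/measurable_EFinP.
- apply: filterS hg => z hz _; apply: cvg_EFin; first exact: nearW.
  apply/cvgrPdist_le => e e0.
  have /cvg_at_leftP /(_ r_ (conj r1 cr)) /cvgrPdist_le /(_ e e0) := hz.
  apply: filterS => n; rewrite sub0r normrN ger0_norm ?cmod_ge0//.
  by rewrite distrC; exact: le_trans (normr_Re_circleB_le _ _ _).
- apply: (@bounded_circle_integrable _ (cst M) `|M|) => //.
- apply: nearW => z n _; rewrite lee_fin (le_trans (normr_Re_le _))//.
  rewrite Normc.normcM cmod_circle mul1r hM// disc_lt1.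
  by rewrite Normc.normcM cmod_circle mulr1 cmod_real.
rewrite (_ : [sequence _]_n = cst 0%E); last first.
  by apply/funext => n; case: (power_series_circle_mean ah (r0 n) (r1 n)).
by move=> /cvg_lim <-//; rewrite lim_cst.
Qed.

End HardyMean.

(** * Matrix entries of bounded analytic operator functions *)

Section Entries.
Variable R : realType.
Local Notation T := (circle R).
Local Notation m := (@circle_measure R).
Implicit Types (x y : ell2 R) (A B : bop R).

Lemma lim_series_single (f : R^nat) n : (forall k, k != n -> f k = 0) ->
  limn (series f) = f n.
Proof.
move=> f0; apply: cvg_lim => //; apply: cvg_near_cst.
exists n.+1 => // k /= nk; rewrite /series/= big_mkord.
rewrite (bigD1 (Ordinal nk))//= big1 ?addr0// => i.
by rewrite -val_eqE/= => /f0.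
Qed.

(** Makes matrix entries instances of the inner products that define weak measurability. *)
Lemma l2inner_delta x n : l2inner x (delta R n) = x n.
Proof.
rewrite /l2inner !(@lim_series_single _ n).
- by rewrite deltaE eqxx conjc1 mulr1; case: (x n).
- by move=> k /negbTE kn; rewrite deltaE kn conjc0 mulr0.
- by move=> k /negbTE kn; rewrite deltaE kn conjc0 mulr0.
Qed.

Lemma cmod_conj (w : R[i]) : cmod w^*%C = cmod w.
Proof. by case: w => a b /=; rewrite sqrrN. Qed.

(** Termwise, [|x_n y_n| <= |x_n|^2 + |y_n|^2]. Convergence ensures that the [limn] in [l2inner] is
    the actual sum. *)
Lemma cvg_l2inner x y :
  cvgn (series (fun n => complex.Re (x n * (y n)^*%C))) /\
  cvgn (series (fun n => complex.Im (x n * (y n)^*%C))).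
Proof.
have h : cvgn (series ((fun n => cmod (x n) ^+ 2) + (fun n => cmod (y n) ^+ 2) : R^nat)).
  by apply: is_cvg_seriesD; exact: cvg_l2series.
have xy n : cmod (x n * (y n)^*%C) <= cmod (x n) ^+ 2 + cmod (y n) ^+ 2.
  rewrite Normc.normcM cmod_conj; move: (cmod _) (cmod _) => a b.
  by have := sqr_ge0 (a - b); have := sqr_ge0 (a + b); nra.
split; apply: normed_cvg; apply: (series_le_cvg _ _ _ h) => n //=.
- by apply: addr_ge0; exact: sqr_ge0.
- exact: le_trans (normr_Re_le _) (xy n).
- by apply: addr_ge0; exact: sqr_ge0.
- exact: le_trans (normr_Im_le _) (xy n).
Qed.

Lemma Linfty_entry (F : T -> bop R) x n : Linfty F -> cmeasurable (fun z => F z x n).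
Proof.
by case=> mF _; have := mF x (delta R n); under eq_fun do rewrite l2inner_delta.
Qed.

Lemma measurable_Re_circleM (g : T -> R[i]) : cmeasurable g ->
  measurable_fun setT (fun z : T => complex.Re (cval z * g z)).
Proof.
case=> mr mi.
have mRe : measurable_fun setT (fun z : T => complex.Re (cval z)).
  by have := @measurable_Re_monomial R 1 1; under eq_fun do rewrite mul1r expr1.
have mIm : measurable_fun setT (fun z : T => complex.Im (cval z)).
  (* The imaginary part of z is the real part of [-i z]. *)
  have := @measurable_Re_monomial R (0 +i* -1) 1.
  apply: eq_measurable_fun => z _; rewrite expr1; case: (cval z) => a b /=.
  by ring.
rewrite (_ : (fun z => _) = (fun z : T => complex.Re (cval z) * complex.Re (g z) -
   complex.Im (cval z) * complex.Im (g z))).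
  by apply: measurable_funB; apply: measurable_funM.
by apply/funext => z; case: (cval z) (g z) => ? ? [].
Qed.

Lemma bop_sum_entry (n : nat) (c : 'I_n -> R[i]) (B : 'I_n -> bop R) x k :
  (\sum_(i < n) c i *: B i) x k = \sum_(i < n) c i * B i x k.
Proof.
by rewrite (big_morph (fun D : bop R => D x k) (id1 := 0) (op1 := +%R)).
Qed.

(** This is [hardy_mean] for one scalar entry. Entries are bounded by the operator norm, which
    transfers the power series and the bound, and by the norm of their column, which transfers the
    radial limit. *)
Lemma Hinfty_entry_mean (F : T -> bop R) n k : Hinfty F ->
  (\int[m]_z (complex.Re (cval z * F z (delta R n) k))%:E = 0)%E.
Proof.
move=> [LF [G [[A GA] [M GM] GF]]].
apply: (@hardy_mean _ (fun i => A i (delta R n) k) (fun w => G w (delta R n) k) _ M).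
- move=> w /GA hw; apply: squeeze_cvgr (cvg_cst 0) hw.
  apply: nearW => N; rewrite cmod_ge0/=.
  by have := cmod_entry_le (G w - \sum_(i < N) w ^+ i *: A i) n k; rewrite -bop_sum_entry.
- by move=> w w1; exact: le_trans (cmod_entry_le _ _ _) (GM _ w1).
- apply: filterS GF => z /(_ (delta R n)) hz; apply: squeeze_cvgr (cvg_cst 0) hz.
  by apply: nearW => r; rewrite cmod_ge0/= (le_trans _ (cmod_coord_le _ k)).
- by apply: measurable_Re_circleM; exact: Linfty_entry.
Qed.

Lemma ae_eq0_mean0 (u : T -> R) : measurable_fun setT u ->
  (\forall z \ae m, 0 <= u z) -> (\int[m]_z (u z)%:E = 0)%E ->
  \forall z \ae m, u z = 0.
Proof.
move=> mu u0 iu; have meu : measurable_fun setT (EFin \o u) by exact/measurable_EFinP.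
have : (\int[m]_z `|(EFin \o u) z| = 0)%E.
  rewrite -iu; apply: ae_eq_integral => //.
    exact: measurableT_comp.
  by apply: filterS u0 => z uz _ /=; rewrite ger0_norm.
by move/ae_eq_integral_abs => /(_ measurableT meu); apply: filterS => z /(_ I) [].
Qed.

Lemma Hinfty_entry_eq0 (F : T -> bop R) n k : Hinfty F ->
  (\forall z \ae m, cmod ((cval z)^*%C - F z (delta R n) k) <= 1) ->
  \forall z \ae m, F z (delta R n) k = 0.
Proof.
move=> HF dF; pose g z := F z (delta R n) k.
have gu z : cmod ((cval z)^*%C - g z) <= 1 ->
    cmod (g z) ^+ 2 <= 2 * complex.Re (cval z * g z).
  (* Multiplication by the unimodular z turns [conj z - g] into [1 - z g]; squaring the bound then
     gives the claim. *)
  move=> h; have : cmod (1 - cval z * g z) <= 1.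
    by rewrite -(conj_circle z) mulrC -mulrBr Normc.normcM cmod_circle mul1r.
  have <- : cmod (cval z * g z) = cmod (g z) by rewrite Normc.normcM cmod_circle mul1r.
  case: (cval z * g z) => a b /=.
  rewrite -[X in _ <= X -> _]sqrtr1 ler_sqrt// sqr_sqrtr ?addr_ge0 ?sqr_ge0// sub0r sqrrN.
  by move=> ?; lra.
have mu : measurable_fun setT (fun z => complex.Re (cval z * g z)).
  by apply: measurable_Re_circleM; apply: Linfty_entry; case: HF.
(* The previous bound makes this real part nonnegative; having mean zero, it vanishes, and the bound
   then forces g = 0. *)
have u0 : \forall z \ae m, complex.Re (cval z * g z) = 0.
  apply: ae_eq0_mean0 => //; last exact: Hinfty_entry_mean.
  by apply: filterS dF => z /gu h; have := sqr_ge0 (cmod (g z)); lra.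
apply: filterS2 dF u0 => z /gu + uz; rewrite uz mulr0 => h.
by apply: Normc.eq0_normc; apply/eqP; rewrite -sqrf_eq0 eq_le h sqr_ge0.
Qed.

End Entries.

(** * The function [Phi] and its superoptimal approximants *)

Section Example.
Variable R : realType.
Local Notation T := (circle R).
Local Notation m := (@circle_measure R).
Implicit Types (c : R[i]) (F : T -> bop R).

Lemma Phi_subproof (z : T) k : cmod (if k is 0%N then 0 else (cval z)^*%C) <= 1.
Proof. by case: k => [|k]; rewrite ?cmod0 ?ler01// cmod_conj cmod_circle. Qed.

Definition Phi (z : T) : bop R := diag_op (Phi_subproof z).

Lemma corner_subproof c k : cmod (if k is 0%N then c else 0) <= cmod c.
Proof. by case: k => [|k] //; rewrite cmod0 cmod_ge0. Qed.

Definition corner c : bop R := diag_op (corner_subproof c).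

Lemma corner0 : corner 0 = 0.
Proof.
apply/val_inj/funext => x; apply/val_inj/funext => -[|k].
  exact: mul0r.
exact: mul0r.
Qed.

Lemma opnorm0 : opnorm (0 : bop R) = 0.
Proof.
apply/eqP; rewrite eq_le opnorm_ge0 andbT; apply: opnorm_le => // x.
by rewrite mul0r -[X in X <= _]/(l2norm (0 : ell2 R)) l2norm0.
Qed.

Lemma circle_measureT_gt0 : (0 < m setT)%E.
Proof. by rewrite [ltRHS]circle_measureT. Qed.

(** Weak measurability passes to the limit from the partial sums of the inner product, whose terms
    reduce to real parts of monomials in z. *)
Lemma Linfty_Phi : Linfty Phi.
Proof.
split; last first.
  apply: (@le_lt_trans _ _ 1%E); last exact: ltry.
  apply/ess_supP; apply: nearW => z; rewrite lee_fin; apply: opnorm_le => // x.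
  apply: le_l2norm => // n; rewrite diag_opE Normc.normcM.
  by rewrite ler_wpM2r ?cmod_ge0// Phi_subproof.
move=> x y; split.
- apply: (@measurable_fun_cvg _ _ _ _
    (fun N z => series (fun k => complex.Re (Phi z x k * (y k)^*%C)) N)).
    move=> N; apply: measurable_sum => k; case: k => [|k].
      by under eq_fun do rewrite diag_opE mul0r mul0r; exact: measurable_cst.
    (* With w the product of the coordinates, [Re (conj z w) = Re (conj w z)]. *)
    have := @measurable_Re_monomial R ((x k.+1 * (y k.+1)^*%C)^*%C) 1.
    apply: eq_measurable_fun => z _; rewrite expr1 diag_opE -mulrA.
    by move: (x k.+1 * _) (cval z) => [a b] [u v] /=; ring.
  by move=> z _; apply: (cvg_l2inner (Phi z x) y).1.
- apply: (@measurable_fun_cvg _ _ _ _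
    (fun N z => series (fun k => complex.Im (Phi z x k * (y k)^*%C)) N)).
    move=> N; apply: measurable_sum => k; case: k => [|k].
      by under eq_fun do rewrite diag_opE mul0r mul0r; exact: measurable_cst.
    (* Likewise [Im (conj z w) = Re (i conj w z)]. *)
    have := @measurable_Re_monomial R ('i * (x k.+1 * (y k.+1)^*%C)^*%C) 1.
    apply: eq_measurable_fun => z _; rewrite expr1 diag_opE -mulrA.
    by move: (x k.+1 * _) (cval z) => [a b] [u v] /=; ring.
  by move=> z _; apply: (cvg_l2inner (Phi z x) y).2.
Qed.

Lemma Hinfty_corner c : Hinfty (fun=> corner c).
Proof.
split.
  split; first by move=> x y; split; exact: measurable_cst.
  apply: (@le_lt_trans _ _ (opnorm (corner c))%:E); last exact: ltry.
  by apply/ess_supP; exact: nearW.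
exists (fun=> corner c); split.
(* Only the constant term is nonzero, so the partial sums are exact from n = 1 on. *)
- exists (fun k => if k is 0%N then corner c else 0) => w _; apply: cvg_near_cst.
  exists 1%N => // -[//|n] _; rewrite big_ord_recl expr0 scale1r big1 ?addr0.
    by rewrite subrr opnorm0.
  by move=> i _; rewrite scaler0.
- by exists (opnorm (corner c)).
- apply: nearW => z x; under eq_fun do rewrite subrr l2norm0.
  exact: cvg_cst.
Qed.

Lemma opnorm_Phi_corner c z : cmod c <= 1 -> opnorm (Phi z - corner c) <= 1.
Proof.
move=> c1; apply: opnorm_le => // x; apply: le_l2norm => // n.
rewrite -[(Phi z - corner c) x n]/(Phi z x n - corner c x n) !diag_opE.
rewrite -mulrBl Normc.normcM.
rewrite ler_wpM2r ?cmod_ge0//; case: n => [|n]; first by rewrite sub0r cmodN.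
by rewrite subr0 cmod_conj cmod_circle.
Qed.

(** Once the diagonal entries of F off the corner vanish, the norm bound clears the rest of these
    columns of [Phi z - F z]. The vectors [delta n.+1] thus become eigenvectors with the common
    eigenvalue [conj z]. *)
Lemma Hinfty_sval_ge1 F : Hinfty F ->
  (\forall z \ae m, opnorm (Phi z - F z) <= 1) ->
  \forall z \ae m, forall j, 1 <= sval_nth j (Phi z - F z).
Proof.
move=> HF PF1.
have PFE z n k : (Phi z - F z) (delta R n) k = Phi z (delta R n) k - F z (delta R n) k.
  by [].
have PFd z n : (Phi z - F z) (delta R n.+1) n.+1 =
    (cval z)^*%C - F z (delta R n.+1) n.+1.
  by rewrite PFE diag_opE deltaE eqxx mulr1.
have : \forall z \ae m, forall n, F z (delta R n.+1) n.+1 = 0.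
  (* There are countably many entries, so one null set serves for all n. *)
  apply: ae_foralln => n; apply: Hinfty_entry_eq0 => //.
  by apply: filterS PF1 => z; apply: le_trans; rewrite -PFd cmod_entry_le.
apply: filterS2 PF1 => z PF1 F0 j.
apply: (@sval_nth_ge1 _ _ _ (cval z)^*%C); first by rewrite cmod_conj cmod_circle.
move=> n; apply: ell2P => k; rewrite coordsZ deltaE.
have [->|kn] := eqVneq k n.+1; first by rewrite PFd F0 subr0 mulr1.
have := sqr_cmod_coord2_le ((Phi z - F z) (delta R n.+1)) kn.
rewrite PFd F0 subr0 cmod_conj cmod_circle mulr0 => h.
apply: Normc.eq0_normc; apply/eqP; rewrite -sqrf_eq0 eq_le sqr_ge0 andbT.
have : l2norm ((Phi z - F z) (delta R n.+1)) ^+ 2 <= 1.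
  rewrite expr_le1 ?l2norm_ge0// (le_trans _ PF1)// opnorm_ge// l2norm_delta//.
by move: h; rewrite expr1n; lra.
Qed.

Lemma ess_sup_ge1 (f : T -> R) : (\forall z \ae m, 1 <= f z) ->
  (1 <= ess_sup m (fun z => (f z)%:E))%E.
Proof.
move=> f1; rewrite -(ess_sup_cst 1%E circle_measureT_gt0); apply: le_ess_sup.
by apply: filterS f1 => z; rewrite lee_fin.
Qed.

(** [Hinfty_sval_ge1] requires norms at most 1. A deviation below 1 would supply this, and then
    [s_0 >= 1] would bound the norm from below: a contradiction. *)
Lemma deviation0_ge1 F : Hinfty F -> (1 <= deviation Phi 0 F)%E.
Proof.
move=> HF; rewrite leNgt; apply/negP => d1.
have /(Hinfty_sval_ge1 HF) s1 : \forall z \ae m, opnorm (Phi z - F z) <= 1.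
  by have /ess_supP := ltW d1.
move: d1; apply/negP; rewrite -leNgt; apply: ess_sup_ge1.
by apply: filterS s1 => z /(_ 0%N) /le_trans; apply; exact: sval_nth_le_opnorm.
Qed.

(** The bound on the deviation of order 0 is what every competitor of a later stage satisfies. *)
Lemma deviation_ge1 F j : Hinfty F -> (deviation Phi 0 F <= 1)%E ->
  (1 <= deviation Phi j F)%E.
Proof.
move=> HF /ess_supP d1; case: j => [|j]; first exact: deviation0_ge1.
apply: ess_sup_ge1; have := Hinfty_sval_ge1 HF d1.
by apply: filterS => z /(_ j.+1).
Qed.

Lemma deviation_corner c j : cmod c <= 1 -> deviation Phi j (fun=> corner c) = 1%E.
Proof.
move=> c1; have le1 k : (deviation Phi k (fun=> corner c) <= 1)%E.
  case: k => [|k]; apply/ess_supP; apply: nearW => z; rewrite lee_fin.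
    exact: opnorm_Phi_corner.
  by rewrite (le_trans (sval_nth_le_opnorm _ _))// opnorm_Phi_corner.
by apply/eqP; rewrite eq_le le1 deviation_ge1//; exact: Hinfty_corner.
Qed.

(** At each stage the deviation of a competitor is at least 1 and the corners attain 1, so they
    minimize and survive to the next stage. *)
Lemma competitors_Phi j :
  (forall F, competitors Phi j F -> (1 <= deviation Phi j F)%E) /\
  (forall c, cmod c <= 1 -> competitors Phi j (fun=> corner c)).
Proof.
have HF k F : competitors Phi k F -> Hinfty F.
  by elim: k => // k ih [/ih].
(* A minimizer at stage 0 does no worse than [corner 0], whose deviation is 1. *)
have dF k F : competitors Phi k.+1 F -> (deviation Phi 0 F <= 1)%E.
  elim: k => [[_ /(_ _ (Hinfty_corner 0))]|k ih [/ih]//].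
  by rewrite deviation_corner// cmod0.
have ge1 k F : competitors Phi k F -> (1 <= deviation Phi k F)%E.
  case: k => [|k] kF; first exact: deviation0_ge1.
  exact: deviation_ge1 (HF _ _ kF) (dF _ _ kF).
split; first exact: ge1.
move=> c c1; elim: j => [|j ih]; first exact: Hinfty_corner.
split; first exact: ih.
by move=> G /ge1; rewrite (deviation_corner _ c1).
Qed.

Lemma superopt_corner c : cmod c <= 1 -> superopt_approximant Phi (fun=> corner c).
Proof.
move=> c1 j _; have [ge1 cc] := competitors_Phi j; split; first exact: cc.
by move=> G /ge1; rewrite (deviation_corner _ c1).
Qed.

Lemma superopt_limit_Phi : superopt_limit Phi = 1%E.
Proof.
rewrite /superopt_limit (_ : superopt_value Phi = cst 1%E) ?lim_cst//.
apply/funext => j; have [ge1 cc] := competitors_Phi j.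
apply/eqP; rewrite eq_le; apply/andP; split.
  apply: ereal_inf_lbound; exists (fun=> corner 0); first by apply: cc; rewrite cmod0.
  by rewrite deviation_corner// cmod0.
by apply: le_ereal_inf_tmp => _ [F /ge1 + <-].
Qed.

(* Above t_oo = 1 = |Phi| there are no singular values, so (C) holds with no
   function xi at all. *)
Lemma condition_C_Phi : condition_C Phi.
Proof.
move=> sigma; rewrite superopt_limit_Phi lte_fin => s1.
exists 0%N, (fun i => fun=> 0); split; first by case.
apply: nearW => z; congr (lspan _); apply/seteqP; split=> x.
  case=> j [+ _]; rewrite leNgt => /negP[]; apply: le_lt_trans s1.
  rewrite (le_trans (sval_nth_le_opnorm _ _))//.
  by have := @opnorm_Phi_corner 0 z; rewrite corner0 subr0 cmod0; apply.
by case; case.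
Qed.

(** The circle has positive measure, so functions equal almost everywhere agree at some point;
    comparing the corner entries there gives the claim. *)
Lemma corner_class_inj c c' :
  Linfty_class (fun=> corner c) = Linfty_class (fun=> corner c') -> c = c'.
Proof.
move=> cc'; have : Linfty_class (fun=> corner c') (fun=> corner c').
  by split; [case: (Hinfty_corner c')|exact: nearW].
rewrite -cc' => -[_].
move/(@filter_ex _ _ (ae_properfilter_algebraOfSetsType circle_measureT_gt0)) => [_ h].
have := congr1 (fun A : bop R => A (delta R 0) 0%N) h.
by rewrite !diag_opE deltaE eqxx !mulr1.
Qed.

Lemma infinite_superopt_Phi :
  infinite_set (@Linfty_class R @` superopt_approximant Phi).
Proof.
(* Distinct points of the closed unit disc, so the corners are approximants in pairwise distinct
   classes. *)
pose c (n : nat) : R[i] := (n.+1%:R^-1)%:C.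
apply: (@sub_infinite_set _ ((fun n => Linfty_class (fun=> corner (c n))) @` setT)).
  move=> _ [n _ <-]; exists (fun=> corner (c n)); last by [].
  by apply: superopt_corner; rewrite cmod_real ?invr_ge0// invf_le1// ler1n.
have c_inj : {in [set: nat] &, injective (fun n => Linfty_class (fun=> corner (c n)))}.
  move=> i j _ _ /corner_class_inj [] /invr_inj /eqP.
  by rewrite eqr_nat => /eqP [].
by rewrite (eq_finite_set (inj_card_eq c_inj)); exact: infinite_nat.
Qed.

End Example.

Theorem mainTheorem2 (R : realType) :
  exists Phi : circle R -> bop R,
    [/\ Linfty Phi,
        condition_C Phi,
        very_badly_approximable Phi &
        infinite_set (@Linfty_class R @` superopt_approximant Phi)].
Proof.
exists (@Phi R); split.
- exact: Linfty_Phi.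
- exact: condition_C_Phi.
(* The zero function is the constant [corner 0]. *)
- by rewrite /very_badly_approximable -corner0; apply: superopt_corner; rewrite cmod0.
- exact: infinite_superopt_Phi.
Qed.
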